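(* There exists a unique $\mathbb F$-algebra homomorphism $\psi:\Delta_q\to\hat H_q$ that sends $$A\mapsto t_1t_0+(t_1t_0)^{-1},\qquad B\mapsto t_3t_0+(t_3t_0)^{-1},\qquad C\mapsto t_2t_0+(t_2t_0)^{-1}.$$ The homomorphism $\psi$ sends $$\alpha\mapsto(q^{-1}t_0+qt_0^{-1})(t_1+t_1^{-1})+(t_2+t_2^{-1})(t_3+t_3^{-1}),$$ $$\beta\mapsto(q^{-1}t_0+qt_0^{-1})(t_3+t_3^{-1})+(t_1+t_1^{-1})(t_2+t_2^{-1}),$$ $$\gamma\mapsto(q^{-1}t_0+qt_0^{-1})(t_2+t_2^{-1})+(t_3+t_3^{-1})(t_1+t_1^{-1}).$$
   Context: Algebras are associative with multiplicative identity $1$, and algebra homomorphisms preserve $1$. $\mathbb F$ is a field and $q\in\mathbb F$ is nonzero with $q^4\neq 1$. The universal Askey--Wilson algebra $\Delta_q$ is the $\mathbb F$-algebra defined by generators $A,B,C$ and the relations asserting that each of $$A+\frac{qBC-q^{-1}CB}{q^2-q^{-2}},\qquad B+\frac{qCA-q^{-1}AC}{q^2-q^{-2}},\qquad C+\frac{qAB-q^{-1}BA}{q^2-q^{-2}}$$ is central in $\Delta_q$. The central elements $\alpha,\beta,\gamma$ of $\Delta_q$ are obtained by multiplying these three elements, respectively, by $q+q^{-1}$. The universal DAHA of type $(C_1^\vee,C_1)$, denoted $\hat H_q$, is the $\mathbb F$-algebra defined by generators $t_i^{\pm1}$ ($i\in\{0,1,2,3\}$) and relations: (i) $t_it_i^{-1}=t_i^{-1}t_i=1$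 for each $i$; (ii) $t_i+t_i^{-1}$ is central for each $i$; (iii) $t_0t_1t_2t_3=q^{-1}$. *)

(* Defs.v *)
From HB Require Import structures.
From mathcomp Require Import all_boot all_order all_algebra.
From mathcomp Require Import boolp.
From mathcomp Require Import monalg.

Set Implicit Arguments.
Unset Strict Implicit.
Unset Printing Implicit Defensive.

Import GRing.Theory.
Local Open Scope ring_scope.
Local Open Scope quotient_scope.

Section FreeAlgebra.
Variables (F : fieldType) (I : choiceType).

(* The free associative algebra on I: finitely supported F-linear combinations
   of words over I. *)
Definition free_alg := {malg F[{fmonom I}]}.

HB.instance Definition _ := GRing.Lalgebra.on free_alg.

Definition free_var (i : I) : free_alg := mkmalgU (fmu i) 1.

Lemma malgC_comm (c : F) (x : {malg F[{fmonom I}]}) :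
  x * malgC c = malgC c * x.
Proof.
rewrite {1}[x]monalgE [in RHS](monalgE x) mulr_suml mulr_sumr.
apply: eq_bigr => m _.
by rewrite !malgM_def !fgmulUU mulm1 mul1m mulrC.
Qed.

Fact free_scalerAr (c : F) (x y : free_alg) : c *: (x * y) = x * (c *: y).
Proof.
change (c *: (x * y : {malg F[{fmonom I}]}) =
  (x : {malg F[{fmonom I}]}) * (c *: (y : {malg F[{fmonom I}]}))).
by rewrite -!mul_malgC !mulrA malgC_comm.
Qed.

HB.instance Definition _ :=
  GRing.Lalgebra_isAlgebra.Build F free_alg free_scalerAr.

Variables (B : algType F) (h : I -> B).

Definition word_eval (m : {fmonom I}) : B := \prod_(i <- (m : seq I)) h i.

Fact word_eval_mmorphism : mmorphism word_eval.
Proof.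
split=> [m1 m2|]; rewrite /word_eval.
  have -> : mmul m1 m2 = FMonom (m1 ++ m2) by exact: fmmulE.
  by rewrite big_cat.
have -> : mone = FMonom [::] :> {fmonom I} by exact: fmoneE.
by rewrite big_nil.
Qed.

HB.instance Definition _ := isMultiplicative.Build {fmonom I} B word_eval
  word_eval_mmorphism.

Definition free_eval : free_alg -> B := mmap (in_alg B) word_eval.

Fact free_eval_zmod : zmod_morphism free_eval.
Proof. by move=> x y; apply: (@mmap_is_additive _ _ _ (in_alg B) word_eval). Qed.

Fact free_eval_monoid : monoid_morphism free_eval.
Proof.
have [M1 M2] : multiplicative (mmap (in_alg B) word_eval).
  apply: commr_mmap_is_multiplicative => g m m'.
  by rewrite /GRing.comm /= mulr_algl mulr_algr.
by split.
Qed.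

Fact free_eval_scalable : scalable free_eval.
Proof.
move=> c x; rewrite /free_eval.
by rewrite (mmapZ (f := in_alg B) (h := word_eval)) /= mulr_algl.
Qed.

HB.instance Definition _ :=
  GRing.isZmodMorphism.Build free_alg B free_eval free_eval_zmod.
HB.instance Definition _ :=
  GRing.isMonoidMorphism.Build free_alg B free_eval free_eval_monoid.
HB.instance Definition _ :=
  GRing.isScalable.Build F free_alg B *:%R free_eval free_eval_scalable.

Lemma free_evalE i : free_eval (free_var i) = h i.
Proof.
rewrite /free_eval mmapU /= scale1r mul1r.
by rewrite /word_eval /= fmuE big_seq1.
Qed.

Lemma free_lift : exists f : {lrmorphism free_alg -> B},
  forall i, f (free_var i) = h i.
Proof. by exists free_eval; exact: free_evalE. Qed.

End FreeAlgebra.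


Section QuotientAlgebra.
Variables (F : fieldType) (A : algType F).

(* The two-sided ideal of A generated by the elements satisfying r. *)
Inductive two_sided_ideal (r : A -> Prop) : A -> Prop :=
| ideal_gen x : r x -> two_sided_ideal r x
| ideal_zero : two_sided_ideal r 0
| ideal_sub x y :
    two_sided_ideal r x -> two_sided_ideal r y -> two_sided_ideal r (x - y)
| ideal_mull a x : two_sided_ideal r x -> two_sided_ideal r (a * x)
| ideal_mulr x a : two_sided_ideal r x -> two_sided_ideal r (x * a).

Variables (r : A -> Prop) (proper : ~ two_sided_ideal r 1).

Definition ideal_pred (x : A) : bool := `[< two_sided_ideal r x >].

Fact ideal_pred_zmod_closed : zmod_closed ideal_pred.
Proof.
split=> [|x y]; rewrite !unfold_in; first exact/asboolP/ideal_zero.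
by move=> /asboolP hx /asboolP hy; exact/asboolP/ideal_sub.
Qed.

HB.instance Definition _ :=
  GRing.isZmodClosed.Build A ideal_pred ideal_pred_zmod_closed.

Definition ideal_zmod : zmodClosed A := GRing.ZmodClosed.clone A ideal_pred _.

(* MathComp's algebras are nontrivial rings, hence the argument proper. *)
Definition quot_alg of ~ two_sided_ideal r 1 := Quotient.quot ideal_zmod.

Local Notation Q := (quot_alg proper).

HB.instance Definition _ := Choice.on Q.
HB.instance Definition _ := GRing.Zmodule.on Q.

Definition quot_pi (x : A) : Q := \pi_(Quotient.quot ideal_zmod) x.
Definition quot_repr (u : Q) : A := repr (u : Quotient.quot ideal_zmod).

Lemma quot_reprK : cancel quot_repr quot_pi.
Proof. by move=> u; rewrite /quot_pi /quot_repr reprK. Qed.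

Lemma quot_eqP x y : quot_pi x = quot_pi y <-> two_sided_ideal r (x - y).
Proof.
have e := Quotient.idealrBE ideal_zmod x y.
split=> [h|h].
  by apply/asboolP; move: e; rewrite unfold_in => ->; exact/eqP.
by apply/eqP; rewrite -e unfold_in; exact/asboolP.
Qed.

Lemma quot_repr_pi x : two_sided_ideal r (quot_repr (quot_pi x) - x).
Proof. by apply/quot_eqP; rewrite quot_reprK. Qed.

Fact quot_pi_zmod : zmod_morphism quot_pi.
Proof. by move=> x y; rewrite /quot_pi !piE. Qed.

HB.instance Definition _ := GRing.isZmodMorphism.Build A Q quot_pi quot_pi_zmod.

Definition quot_one : Q := quot_pi 1.
Definition quot_mul (u v : Q) : Q := quot_pi (quot_repr u * quot_repr v).
Definition quot_scale (c : F) (u : Q) : Q := quot_pi (c *: quot_repr u).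

Lemma quot_ideal_add x y :
  two_sided_ideal r x -> two_sided_ideal r y -> two_sided_ideal r (x + y).
Proof.
move=> hx hy; rewrite -[y]opprK; apply: ideal_sub => //.
by rewrite -[- y]add0r; apply: ideal_sub => //; exact: ideal_zero.
Qed.

Lemma quot_piM x y : quot_pi (x * y) = quot_mul (quot_pi x) (quot_pi y).
Proof.
apply/esym/quot_eqP; set x' := quot_repr _; set y' := quot_repr _.
have -> : x' * y' - x * y = (x' - x) * y' + x * (y' - y).
  by rewrite mulrBl mulrBr addrA subrK.
by apply: quot_ideal_add; [apply: ideal_mulr|apply: ideal_mull];
  exact: quot_repr_pi.
Qed.

Lemma quot_piZ c x : quot_pi (c *: x) = quot_scale c (quot_pi x).
Proof.
apply/esym/quot_eqP; rewrite -scalerBr -mulr_algl.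
exact/ideal_mull/quot_repr_pi.
Qed.

Fact quot_mulA : associative quot_mul.
Proof.
move=> u v w; rewrite -[u]quot_reprK -[v]quot_reprK -[w]quot_reprK.
by rewrite -!quot_piM mulrA.
Qed.
Fact quot_mul1 : left_id quot_one quot_mul.
Proof. by move=> u; rewrite -[u]quot_reprK -quot_piM mul1r. Qed.
Fact quot_mulr1 : right_id quot_one quot_mul.
Proof. by move=> u; rewrite -[u]quot_reprK -quot_piM mulr1. Qed.
Fact quot_mulDl : left_distributive quot_mul +%R.
Proof.
move=> u v w; rewrite -[u]quot_reprK -[v]quot_reprK -[w]quot_reprK.
by rewrite -raddfD -!quot_piM -raddfD mulrDl.
Qed.
Fact quot_mulDr : right_distributive quot_mul +%R.
Proof.
move=> u v w; rewrite -[u]quot_reprK -[v]quot_reprK -[w]quot_reprK.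
by rewrite -raddfD -!quot_piM -raddfD mulrDr.
Qed.
Fact quot_oner_neq0 : quot_one != 0.
Proof.
apply/eqP; rewrite -(raddf0 quot_pi) => /quot_eqP.
by rewrite subr0; exact: proper.
Qed.

HB.instance Definition _ := GRing.Zmodule_isNzRing.Build Q
  quot_mulA quot_mul1 quot_mulr1 quot_mulDl quot_mulDr quot_oner_neq0.

Fact quot_scalerA a b u : quot_scale a (quot_scale b u) = quot_scale (a * b) u.
Proof. by rewrite -[u]quot_reprK -!quot_piZ scalerA. Qed.
Fact quot_scale1r : left_id 1 quot_scale.
Proof. by move=> u; rewrite -[u]quot_reprK -quot_piZ scale1r. Qed.
Fact quot_scalerDr : right_distributive quot_scale +%R.
Proof.
move=> c u v; rewrite -[u]quot_reprK -[v]quot_reprK.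
by rewrite -raddfD -!quot_piZ -raddfD scalerDr.
Qed.
Fact quot_scalerDl u : {morph quot_scale^~ u : a b / a + b}.
Proof.
by move=> a b; rewrite /= -[u]quot_reprK -!quot_piZ -raddfD scalerDl.
Qed.

HB.instance Definition _ := GRing.Zmodule_isLmodule.Build F Q
  quot_scalerA quot_scale1r quot_scalerDr quot_scalerDl.

Fact quot_scalerAl (c : F) (u v : Q) : c *: (u * v) = (c *: u) * v.
Proof.
rewrite -[u]quot_reprK -[v]quot_reprK; set x := quot_repr u; set y := quot_repr v.
change (quot_scale c (quot_mul (quot_pi x) (quot_pi y)) =
  quot_mul (quot_scale c (quot_pi x)) (quot_pi y)).
by rewrite -quot_piM -!quot_piZ -quot_piM scalerAl.
Qed.

HB.instance Definition _ := GRing.Lmodule_isLalgebra.Build F Q quot_scalerAl.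

Fact quot_scalerAr (c : F) (u v : Q) : c *: (u * v) = u * (c *: v).
Proof.
rewrite -[u]quot_reprK -[v]quot_reprK; set x := quot_repr u; set y := quot_repr v.
change (quot_scale c (quot_mul (quot_pi x) (quot_pi y)) =
  quot_mul (quot_pi x) (quot_scale c (quot_pi y))).
by rewrite -quot_piM -!quot_piZ -quot_piM scalerAr.
Qed.

HB.instance Definition _ := GRing.Lalgebra_isAlgebra.Build F Q quot_scalerAr.

Fact quot_pi_monoid : monoid_morphism quot_pi.
Proof. by split=> // x y; exact: quot_piM. Qed.
Fact quot_pi_scalable : scalable quot_pi.
Proof. by move=> c x; exact: quot_piZ. Qed.

HB.instance Definition _ :=
  GRing.isMonoidMorphism.Build A Q quot_pi quot_pi_monoid.
HB.instance Definition _ :=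
  GRing.isScalable.Build F A Q *:%R quot_pi quot_pi_scalable.

Lemma quot_relB x y : r (x - y) -> quot_pi x = quot_pi y.
Proof. by move=> rxy; apply/quot_eqP/ideal_gen. Qed.

Lemma quot_relM1 x y : r (x * y - 1) -> quot_pi x * quot_pi y = 1.
Proof. by move=> /quot_relB; rewrite rmorphM rmorph1. Qed.

(* x^-1 is the two-sided inverse of x when there is one, and x otherwise. *)
Definition quot_invertible : pred Q :=
  fun u => `[< exists v : Q, v * u = 1 /\ u * v = 1 >].
Definition quot_inv (u : Q) : Q :=
  if pselect (exists v : Q, v * u = 1 /\ u * v = 1) is left h
  then projT1 (cid h) else u.

Fact quot_mulVr : {in quot_invertible, left_inverse 1 quot_inv *%R}.
Proof.
move=> u /asboolP hu; rewrite /quot_inv; case: pselect => // h.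
by case: cid => v [].
Qed.
Fact quot_divrr : {in quot_invertible, right_inverse 1 quot_inv *%R}.
Proof.
move=> u /asboolP hu; rewrite /quot_inv; case: pselect => // h.
by case: cid => v [].
Qed.
Fact quot_unitrP (u v : Q) : v * u = 1 /\ u * v = 1 -> quot_invertible u.
Proof. by move=> h; apply/asboolP; exists v. Qed.
Fact quot_invr_out : {in [predC quot_invertible], quot_inv =1 id}.
Proof.
by move=> u /asboolP hu; rewrite /quot_inv; case: pselect.
Qed.

HB.instance Definition _ := GRing.NzRing_hasMulInverse.Build Q
  quot_mulVr quot_divrr quot_unitrP quot_invr_out.

Section Lift.
Variables (B : algType F) (f : {lrmorphism A -> B}).
Hypothesis f_rel : forall x, r x -> f x = 0.

Lemma ideal_ker x : two_sided_ideal r x -> f x = 0.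
Proof.
elim=> {x} [x /f_rel //||x y _ hx _ hy|a x _ hx|x a _ hx].
- exact: raddf0.
- by rewrite raddfB /= hx hy subr0.
- by rewrite rmorphM /= hx mulr0.
- by rewrite rmorphM /= hx mul0r.
Qed.

Lemma quot_lift : exists g : {lrmorphism Q -> B}, forall x, g (quot_pi x) = f x.
Proof.
pose g (u : Q) := f (quot_repr u).
have gE x : g (quot_pi x) = f x.
  apply/eqP; rewrite -subr_eq0 -raddfB; apply/eqP.
  exact/ideal_ker/quot_repr_pi.
have g_zmod : zmod_morphism g.
  move=> u v; rewrite -[u]quot_reprK -[v]quot_reprK.
  by rewrite -raddfB !gE raddfB.
have g_mon : monoid_morphism g.
  split=> [|u v]; first by rewrite -(rmorph1 quot_pi) gE rmorph1.
  by rewrite -[u]quot_reprK -[v]quot_reprK -rmorphM !gE rmorphM.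
have g_scal : scalable g.
  by move=> c u; rewrite -[u]quot_reprK -linearZ !gE linearZ.
pose g0 := GRing.isZmodMorphism.Build Q B g g_zmod.
pose g1 := GRing.isMonoidMorphism.Build Q B g g_mon.
pose g2 := GRing.isScalable.Build F Q B *:%R g g_scal.
pose gg : {lrmorphism Q -> B} := HB.pack g g0 g1 g2.
by exists gg.
Qed.
End Lift.

End QuotientAlgebra.

Lemma proper_ideal_of_hom (F : fieldType) (A B : algType F) (r : A -> Prop)
    (f : {lrmorphism A -> B}) :
  (forall x, r x -> f x = 0) -> ~ two_sided_ideal r 1.
Proof.
move=> f_rel /(ideal_ker f_rel) /eqP.
by rewrite rmorph1 oner_eq0.
Qed.


Lemma unitr_inv_unique (R : unitRingType) (x y : R) :
  x * y = 1 -> y * x = 1 -> x \is a GRing.unit /\ x^-1 = y.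
Proof.
move=> xy yx; have ux : x \is a GRing.unit by apply/unitrP; exists y.
by split=> //; apply: (mulrI ux); rewrite divrr.
Qed.

Lemma hom_comm_eq0 (F : fieldType) (A : algType F) (f : {lrmorphism A -> F^o})
    (c x : A) : f (c * x - x * c) = 0.
Proof. by rewrite rmorphB !rmorphM [X in X - _]mulrC subrr. Qed.

Section AskeyWilson.
Variables (F : fieldType) (q : F).

Definition AW_comb (A : algType F) (x y z : A) : A :=
  x + (q ^+ 2 - q ^- 2)^-1 *: (q *: (y * z) - q^-1 *: (z * y)).

Local Notation fA := (free_var F (0 : 'I_3)).
Local Notation fB := (free_var F (1 : 'I_3)).
Local Notation fC := (free_var F (2 : 'I_3)).

Variant AW_rel : free_alg F 'I_3 -> Prop :=
| AW_rel_A x : AW_rel (AW_comb fA fB fC * x - x * AW_comb fA fB fC)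
| AW_rel_B x : AW_rel (AW_comb fB fC fA * x - x * AW_comb fB fC fA)
| AW_rel_C x : AW_rel (AW_comb fC fA fB * x - x * AW_comb fC fA fB).

Fact AW_proper : ~ two_sided_ideal AW_rel 1.
Proof.
have [f _] := free_lift (fun _ : 'I_3 => 0 : F^o).
by apply: (@proper_ideal_of_hom _ _ _ _ f) => _ [] x; exact: hom_comm_eq0.
Qed.

Definition AW_algebra : unitAlgType F := quot_alg AW_proper.

Definition AW_A : AW_algebra := quot_pi AW_proper fA.
Definition AW_B : AW_algebra := quot_pi AW_proper fB.
Definition AW_C : AW_algebra := quot_pi AW_proper fC.

Definition AW_alpha : AW_algebra := (q + q^-1) *: AW_comb AW_A AW_B AW_C.
Definition AW_beta : AW_algebra := (q + q^-1) *: AW_comb AW_B AW_C AW_A.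
Definition AW_gamma : AW_algebra := (q + q^-1) *: AW_comb AW_C AW_A AW_B.

End AskeyWilson.

Section DAHA.
Variables (F : fieldType) (q : F).

(* (i, false) is the generator t_i and (i, true) the generator t_i^{-1}. *)
Local Notation ft i := (free_var F ((i : 'I_4), false)).
Local Notation ftV i := (free_var F ((i : 'I_4), true)).

Variant DAHA_rel : free_alg F ('I_4 * bool)%type -> Prop :=
| DAHA_rel_divrr i : DAHA_rel (ft i * ftV i - 1)
| DAHA_rel_mulVr i : DAHA_rel (ftV i * ft i - 1)
| DAHA_rel_central i x :
    DAHA_rel ((ft i + ftV i) * x - x * (ft i + ftV i))
| DAHA_rel_prod : DAHA_rel (ft 0 * ft 1 * ft 2 * ft 3 - q^-1%:A).

(* The character t_0 |-> q^-1, t_1, t_2, t_3 |-> 1. *)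
Fact DAHA_proper : q != 0 -> ~ two_sided_ideal DAHA_rel 1.
Proof.
move=> q0.
pose h (g : 'I_4 * bool) : F^o :=
  if g.1 == 0 then (if g.2 then q else q^-1) else 1.
have [f fE] := free_lift h.
apply: (@proper_ideal_of_hom _ _ _ _ f) => _ [i|i|i x|].
- rewrite rmorphB rmorphM rmorph1 /= !fE /h /=.
  by case: (i == 0); rewrite ?mulVf ?mulr1 // subrr.
- rewrite rmorphB rmorphM rmorph1 /= !fE /h /=.
  by case: (i == 0); rewrite ?mulfV ?mulr1 // subrr.
- exact: hom_comm_eq0.
- rewrite rmorphB !rmorphM /= (linearZ_LR f) rmorph1 !fE /h /= !mulr1.
  by apply/eqP; rewrite subr_eq0; apply/eqP; rewrite -[LHS]mulr1.
Qed.

Variable q_neq0 : q != 0.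

Definition DAHA : unitAlgType F := quot_alg (DAHA_proper q_neq0).

Definition DAHA_t (i : 'I_4) : DAHA := quot_pi (DAHA_proper q_neq0) (ft i).
Definition DAHA_tV (i : 'I_4) : DAHA := quot_pi (DAHA_proper q_neq0) (ftV i).

Lemma DAHA_tVt i : DAHA_tV i * DAHA_t i = 1.
Proof. exact: (quot_relM1 (DAHA_proper q_neq0) (DAHA_rel_mulVr i)). Qed.

Lemma DAHA_ttV i : DAHA_t i * DAHA_tV i = 1.
Proof. exact: (quot_relM1 (DAHA_proper q_neq0) (DAHA_rel_divrr i)). Qed.

(* In the ring DAHA, the inverse of t_i is the generator t_i^{-1}. *)
Lemma DAHA_t_inv i : DAHA_t i \is a GRing.unit /\ (DAHA_t i)^-1 = DAHA_tV i.
Proof. exact: unitr_inv_unique (DAHA_ttV i) (DAHA_tVt i). Qed.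

End DAHA.

(* Main.v *)
Require Import Defs.
From HB Require Import structures.
From mathcomp Require Import all_boot all_order all_algebra.
From mathcomp Require Import monalg.

(** Write T_i = t_i + t_i^-1, and A, B, C for the images prescribed by the
    theorem. Two facts about the universal DAHA carry the proof.

    First, t_0 commutes with A, B and C: centrality of T_0 and T_i makes
    t_i t_0 + (t_i t_0)^-1 equal to t_0 t_i + (t_0 t_i)^-1, its conjugate by t_0
    (recip_sumC, recip_sum_comm).

    Secondly, one has the identity
      (q^2 - q^-2) A + q B C - q^-1 C B
        = (q - q^-1) ((q^-1 t_0 + q t_0^-1) T_1 + T_2 T_3),
    which is AW_identity. It is proved by a computation with the words in
    t_0, t_1, t_2 and their inverses: from t_0 t_1 t_2 t_3 = q^-1 one gets
    B = q t_1 t_2 + q^-1 (t_1 t_2)^-1, while T_3 is a linear combination of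
    t_0 t_1 t_2 and its inverse, which allows these two to be traded for each
    other in B C and C B. The analogous identities for B and C follow by symmetry:
    the quadruple (t_0, t_0^-1 t_3 t_0, t_1, t_2) satisfies the same relations, and
    replacing the original quadruple by it permutes A, B, C cyclically
    (daha_rotate).

    Division by (q - q^-1), which q^4 <> 1 permits, turns these identities into
    the asserted formulas for the images of alpha, beta and gamma. The right-hand
    sides are polynomials in t_0, t_0^-1 and central elements, so by the first
    fact they commute with A, B and C. Hence the defining relations of Delta_q
    hold in the subalgebra generated by A, B and C, which gives the homomorphism;
    it is unique because A, B and C generate Delta_q. *)

Set Implicit Arguments.
Unset Strict Implicit.
Unset Printing Implicit Defensive.

Import GRing.Theory.
Local Open Scope ring_scope.

(** * Free algebras *)

Section FreeAlgebraInduction.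
Variables (F : fieldType) (I : choiceType).

(** Every element is a combination of words and every word is a product of
    variables, so a property closed under the operations propagates from the
    variables. *)
Lemma free_alg_ind (P : free_alg F I -> Prop) :
    P 1 -> (forall i, P (free_var F i)) ->
    (forall x y, P x -> P y -> P (x + y)) ->
    (forall x y, P x -> P y -> P (x * y)) ->
    (forall c x, P x -> P (c *: x)) ->
  forall x, P x.
Proof.
move=> P1 Pvar PD PM PZ x.
have P0 : P 0 by rewrite -(scale0r 1); exact: PZ.
have mulU (c1 c2 : F) (m1 m2 : {fmonom I}) :
    (mkmalgU m1 c1 : free_alg F I) * mkmalgU m2 c2
    = mkmalgU (mmul m1 m2) (c1 * c2).
  change ((mkmalgU m1 c1 : {malg F[{fmonom I}]}) * mkmalgU m2 c2
    = mkmalgU (mmul m1 m2) (c1 * c2)).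
  by rewrite malgM_def fgmulUU.
have Pword (s : seq I) : P (mkmalgU (FMonom s) 1).
  elim: s => [|i s IHs].
    have -> : FMonom [::] = mone :> {fmonom I} by rewrite -fmoneE.
    exact: P1.
  have -> : FMonom (i :: s) = mmul (fmu i) (FMonom s) :> {fmonom I}.
    by apply/esym; rewrite fmuE; exact: fmmulE.
  by rewrite -[X in mkmalgU _ X]mulr1 -mulU; apply: PM; first exact: Pvar.
rewrite [x]monalgE; apply: big_ind => // -[s] _.
set c := (x : {malg _[_]})@_ _.
have -> : mkmalgU (FMonom s) c = c *: (mkmalgU (FMonom s) 1 : free_alg F I).
  change (mkmalgU (FMonom s) c
    = c *: (mkmalgU (FMonom s) 1 : {malg F[{fmonom I}]})).
  apply/malgP=> k; rewrite mcoeffZ !mcoeffU.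
  by case: (_ == _); rewrite ?mulr1 ?mulr0.
exact: PZ.
Qed.

End FreeAlgebraInduction.

Lemma comm_free_image (F : fieldType) (I : choiceType) (B : algType F)
    (f : {lrmorphism free_alg F I -> B}) (z : B) :
  (forall i, GRing.comm z (f (free_var F i))) -> forall x, GRing.comm z (f x).
Proof.
move=> zf; apply: free_alg_ind => [|//|x y cx cy|x y cx cy|c x cx].
- by rewrite rmorph1; exact: commr1.
- by rewrite raddfD; exact: commrD.
- by rewrite rmorphM; exact: commrM.
- by rewrite linearZ /GRing.comm -scalerAl -scalerAr cx.
Qed.

(** * Elements with central reciprocal sum *)

Definition central (R : nzRingType) (c : R) := forall w : R, c * w = w * c.

Section DahaQuadruples.
Variables (F : fieldType) (R : unitAlgType F).
Implicit Types x y z u v w : R.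

Definition recip_sum x := x + x^-1.

Lemma recip_sum_collapse u x v : central (recip_sum x) ->
  u * x * v + u * x^-1 * v = recip_sum x * (u * v).
Proof. by move=> cx; rewrite -mulrDl -mulrDr -cx mulrA. Qed.

(** After adding x y^-1 to both sides, x moves across y + y^-1 and then y^-1
    across x + x^-1. *)
Lemma recip_sumC x y : x \is a GRing.unit -> y \is a GRing.unit ->
  central (recip_sum x) -> central (recip_sum y) ->
  recip_sum (x * y) = recip_sum (y * x).
Proof.
move=> ux uy cx cy; rewrite /recip_sum !invrM //.
have ey : x * y + x * y^-1 = y * x + y^-1 * x.
  by rewrite -mulrDr -mulrDl; exact: (esym (cy x)).
have ex : y^-1 * x + y^-1 * x^-1 = x * y^-1 + x^-1 * y^-1.
  by rewrite -mulrDr -mulrDl; exact: (esym (cx y^-1)).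
apply: (addIr (x * y^-1)); rewrite addrAC ey -addrA ex.
by rewrite [_ * _ + x^-1 * _]addrC addrA.
Qed.

(** Conjugation by x exchanges y x and x y, and these have the same
    reciprocal sum. *)
Lemma recip_sum_comm x y : x \is a GRing.unit -> y \is a GRing.unit ->
  central (recip_sum x) -> central (recip_sum y) ->
  GRing.comm x (recip_sum (y * x)).
Proof.
move=> ux uy cx cy; rewrite /GRing.comm -{2}recip_sumC // /recip_sum.
by rewrite mulrDl mulrDr !invrM // !mulrA mulrV // mul1r mulrVK.
Qed.

Variable q : F.
Hypothesis q_neq0 : q != 0.

(** * The Askey-Wilson identity *)

(** Here x, y, z stand for t_0, t_1, t_2, and S for t_3 + t_3^-1, expressed
    through the product x y z; the element a is then t_3 t_0 + (t_3 t_0)^-1.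
    By means of S, each of xyz and yzx can be replaced by its inverse. Once this
    is done, the words of length four that remain form pairs which differ only by
    exchanging y and y^-1, so that each pair collapses to y + y^-1 times x or
    x^-1. The words of length two in x and y are paired in the same way with
    those of y x + (y x)^-1, and the words in z add up to S times z + z^-1. *)
Lemma AW_identity x y z S (a := q *: (y * z) + q^-1 *: (y * z)^-1) :
  x \is a GRing.unit -> y \is a GRing.unit -> z \is a GRing.unit ->
  central (recip_sum x) -> central (recip_sum y) -> central (recip_sum z) ->
  central S -> q *: (x * y * z) + q^-1 *: (x * y * z)^-1 = S ->
  (q ^+ 2 - q ^- 2) *: recip_sum (y * x)
    + (q *: (a * recip_sum (z * x)) - q^-1 *: (recip_sum (z * x) * a))
  = (q - q^-1) *: ((q^-1 *: x + q *: x^-1) * recip_sum y + recip_sum z * S).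
Proof.
move=> ux uy uz cx cy cz cS hS.
have uxy : x * y \is a GRing.unit by rewrite unitrMl.
have uyz : y * z \is a GRing.unit by rewrite unitrMl.
(* Applied to xyz and to its conjugate yzx, which has the same S because S is
   central. *)
have solve (w : R) : q *: w + q^-1 *: w^-1 = S ->
  [/\ q ^+ 2 *: w = q *: S - w^-1, w^-1 = q *: S - q ^+ 2 *: w,
      w = q^-1 *: S - q ^- 2 *: w^-1 & q ^- 2 *: w^-1 = q^-1 *: S - w].
  move=> <-; rewrite !scalerDr !scalerA -invfM -expr2 mulfV // mulVf // !scale1r.
  split.
  - by rewrite addrK.
  - by rewrite addrC addKr.
  - by rewrite addrK.
  - by rewrite addrC addKr.
have [xyz2 xyzV xyz1 xyzV2] := solve _ hS.
have hS' : q *: (y * z * x) + q^-1 *: (y * z * x)^-1 = S.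
  have -> : y * z * x = x^-1 * (x * y * z) * x by rewrite !mulrA mulVr // mul1r.
  have -> : (x^-1 * (x * y * z) * x)^-1 = x^-1 * (x * y * z)^-1 * x.
    by rewrite !invrM ?unitrMl ?unitrV // invrK !mulrA.
  have pull c w : c *: (x^-1 * w * x) = x^-1 * (c *: w) * x.
    by rewrite -scalerAr -scalerAl.
  by rewrite !pull -mulrDl -mulrDr hS -cS mulrVK.
have [yzx2 yzxV yzx1 yzxV2] := solve _ hS'.
have Vxyz : (x * y * z)^-1 = z^-1 * (y^-1 * x^-1) by rewrite !invrM.
have Vyzx : (y * z * x)^-1 = x^-1 * (z^-1 * y^-1) by rewrite !invrM.
rewrite {}Vxyz in xyz2 xyzV xyz1 xyzV2; rewrite {}Vyzx in yzx2 yzxV yzx1 yzxV2.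
(* Between zx + (zx)^-1 and xz + (xz)^-1 the choice is made so that each of the
   four products below has a factor xyz, yzx or the inverse of one of these. *)
have zC : recip_sum (z * x) = recip_sum (x * z) by rewrite recip_sumC.
have H1 : q ^+ 2 *: (y * z * recip_sum (z * x))
    = q *: (S * z) - x^-1 * z^-1 * y^-1 * z + q ^+ 2 *: (y * x^-1).
  rewrite zC /recip_sum invrM // mulrDr !mulrA mulrK // scalerDr.
  by rewrite [in LHS]scalerAl yzx2 mulrBl -scalerAl !mulrA.
have H2 : recip_sum (z * x) * (y * z) = q^-1 *: (S * z)
    - q ^- 2 *: (y^-1 * x^-1) + x^-1 * z^-1 * y * z.
  rewrite /recip_sum invrM // mulrDl !mulrA; congr (_ + _).
  have -> : z * x * y * z = z * (x * y * z) by rewrite !mulrA.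
  rewrite xyz1 mulrBr -!scalerAr -cS.
  by rewrite mulVKr.
have H3 : (y * z)^-1 * recip_sum (z * x)
    = z^-1 * y^-1 * z * x + q *: (S * z^-1) - q ^+ 2 *: (x * y).
  rewrite /recip_sum !invrM // mulrDr !mulrA -addrA; congr (_ + _).
  rewrite -[_ * y^-1 * x^-1]mulrA xyzV mulrBl -!scalerAl.
  by rewrite mulrK.
have H4 : q ^- 2 *: (recip_sum (z * x) * (y * z)^-1)
    = q ^- 2 *: (x * y^-1) + q^-1 *: (S * z^-1) - z^-1 * y * z * x.
  rewrite zC /recip_sum [(y * z)^-1]invrM // [(x * z)^-1]invrM //.
  rewrite mulrDl !mulrA mulrK // scalerDr -addrA.
  congr (_ + _); rewrite -!mulrA scalerAr yzxV2.
  by rewrite mulrBr -!scalerAr -cS !mulrA.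
have H0 : q *: (a * recip_sum (z * x)) - q^-1 *: (recip_sum (z * x) * a)
    = (q ^+ 2 *: (y * z * recip_sum (z * x)) + (y * z)^-1 * recip_sum (z * x))
    - (recip_sum (z * x) * (y * z)
       + q ^- 2 *: (recip_sum (z * x) * (y * z)^-1)).
  move: (recip_sum (z * x)) => c.
  rewrite /a mulrDl mulrDr -!scalerAl -!scalerAr !scalerDr !scalerA.
  by rewrite -invfM -expr2 mulfV // mulVf // !scale1r.
(* The words y x^-1 and x y^-1 find their partners in
   x y + (x y)^-1 = y x + (y x)^-1, which also cancels x y and y^-1 x^-1. *)
have hy : q ^+ 2 *: recip_sum (y * x) + q ^+ 2 *: (y * x^-1) - q ^+ 2 *: (x * y)
    = q ^+ 2 *: (recip_sum y * x^-1).
  rewrite -scalerDr -scalerBr; congr (_ *: _).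
  rewrite -recip_sumC // /recip_sum invrM //.
  by rewrite -addrA [x * y + _]addrC addrAC -addrA addrC subrK mulrDl.
have hyV : q ^- 2 *: recip_sum (y * x) - q ^- 2 *: (y^-1 * x^-1)
     + q ^- 2 *: (x * y^-1) = q ^- 2 *: (recip_sum y * x).
  rewrite -scalerBr -scalerDr; congr (_ *: _).
  by rewrite -recip_sumC // /recip_sum invrM // addrK -mulrDr cy.
have hz : x^-1 * z^-1 * y^-1 * z + x^-1 * z^-1 * y * z = recip_sum y * x^-1.
  by rewrite addrC recip_sum_collapse // mulrVK.
have hzV : z^-1 * y^-1 * z * x + z^-1 * y * z * x = recip_sum y * x.
  by rewrite addrC -!mulrA !mulrA -!mulrDl -mulrDr -cy -!mulrA mulKr.
have hTy : (q - q^-1) *: ((q^-1 *: x + q *: x^-1) * recip_sum y)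
    = q ^+ 2 *: (recip_sum y * x^-1) - recip_sum y * x^-1
      + (recip_sum y * x - q ^- 2 *: (recip_sum y * x)).
  rewrite -cy; move: (recip_sum y) => c.
  rewrite mulrDr -!scalerAr scalerDr !scalerA !mulrBl -invfM -expr2.
  by rewrite mulfV // mulVf // !scalerBl !scale1r addrC.
have hTz : (q - q^-1) *: (recip_sum z * S)
    = q *: (S * z) + q *: (S * z^-1) - (q^-1 *: (S * z) + q^-1 *: (S * z^-1)).
  by rewrite -!scalerDr -mulrDr -scalerBl cz.
rewrite H0 H1 H2 H3 H4 [RHS]scalerDr hTy hTz -hy -hyV -hz -hzV scalerBl.
rewrite !opprD !opprK !addrA.
(* Both sides are the same sum of fourteen terms. *)
by rewrite [LHS](ACl (1*5*8*4*11*6*14*2*10*12*3*7*9*13)).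
Qed.

(** * Quadruples satisfying the DAHA relations *)

Record daha_quadruple (t0 t1 t2 t3 : R) : Prop := DahaQuadruple {
  daha_unit0 : t0 \is a GRing.unit;
  daha_unit1 : t1 \is a GRing.unit;
  daha_unit2 : t2 \is a GRing.unit;
  daha_unit3 : t3 \is a GRing.unit;
  daha_central0 : central (recip_sum t0);
  daha_central1 : central (recip_sum t1);
  daha_central2 : central (recip_sum t2);
  daha_central3 : central (recip_sum t3);
  daha_prod : t0 * t1 * t2 * t3 = q^-1%:A }.

Lemma recip_sum_conj x w : x \is a GRing.unit -> w \is a GRing.unit ->
  recip_sum (x^-1 * w * x) = x^-1 * recip_sum w * x.
Proof.
move=> ux uw; rewrite /recip_sum mulrDr mulrDl !invrM ?unitrMl ?unitrV //.
by rewrite invrK !mulrA.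
Qed.

Lemma recip_sum_conj_fixed x w : x \is a GRing.unit -> w \is a GRing.unit ->
  GRing.comm x (recip_sum w) -> recip_sum (x^-1 * w * x) = recip_sum w.
Proof. by move=> ux uw xw; rewrite recip_sum_conj // -mulrA -xw mulKr. Qed.

(** The product of a daha_quadruple is a scalar, so it is invariant under cyclic
    permutation of its factors; t_3 is moved to the front and then across t_0 by
    conjugation. Since this fixes t_0, it induces the 3-cycle A -> B -> C -> A on
    the three Askey-Wilson elements. *)
Lemma daha_rotate t0 t1 t2 t3 : daha_quadruple t0 t1 t2 t3 ->
  daha_quadruple t0 (t0^-1 * t3 * t0) t1 t2.
Proof.
case=> u0 u1 u2 u3 c0 c1 c2 c3 p.
have T3 : recip_sum (t0^-1 * t3 * t0) = recip_sum t3.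
  by apply: recip_sum_conj_fixed => //; exact/esym/c3.
split=> //; first by rewrite !unitrMl // unitrV.
  by rewrite T3.
have -> : t0 * (t0^-1 * t3 * t0) * t1 * t2 = t3 * (t0 * t1 * t2 * t3) * t3^-1.
  by rewrite !mulrA mulrV // mul1r mulrK.
by rewrite p -scalerAr -scalerAl mulr1 mulrV.
Qed.

(** The image of alpha; permuting t_1, t_2, t_3 cyclically gives the images of
    beta and gamma. *)
Definition daha_alpha (t0 t1 t2 t3 : R) :=
  (q^-1 *: t0 + q *: t0^-1) * recip_sum t1 + recip_sum t2 * recip_sum t3.

Hypothesis q4_neq1 : q ^+ 4 != 1.

Lemma q2_subV_neq0 : q ^+ 2 - q ^- 2 != 0.
Proof.
apply: contra q4_neq1 => /eqP/subr0_eq e.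
by rewrite (exprM q 2 2) [_ ^+ 2 ^+ 2]expr2 {1}e mulVf // expf_neq0.
Qed.

Lemma q2_subVE : q ^+ 2 - q ^- 2 = (q - q^-1) * (q + q^-1).
Proof. by rewrite -subr_sqr exprVn. Qed.

Lemma q_addV_neq0 : q + q^-1 != 0.
Proof. by have := q2_subV_neq0; rewrite q2_subVE mulf_eq0 negb_or => /andP[]. Qed.

(** The relation t_0 t_1 t_2 t_3 = q^-1 gives t_3 t_0 = q^-1 (t_1 t_2)^-1 and
    expresses t_3 + t_3^-1 through t_0 t_1 t_2, which is the situation of
    AW_identity. *)
Lemma daha_AW_comb t0 t1 t2 t3 : daha_quadruple t0 t1 t2 t3 ->
  (q + q^-1) *: AW_comb q (recip_sum (t1 * t0)) (recip_sum (t3 * t0))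
                          (recip_sum (t2 * t0))
  = daha_alpha t0 t1 t2 t3.
Proof.
case=> u0 u1 u2 u3 c0 c1 c2 c3 p.
have qVu : q^-1 \is a GRing.unit by rewrite unitfE invr_neq0.
have e012 : t0 * t1 * t2 = q^-1 *: t3^-1.
  by rewrite -[LHS](mulrK u3) p -scalerAl mul1r.
have e30 : t3 * t0 = q^-1 *: (t1 * t2)^-1.
  have -> : t3 = q^-1 *: (t0 * t1 * t2)^-1.
    by rewrite e012 invrZ // ?unitrV // !invrK scalerA mulVf // scale1r.
  by rewrite -[t0 * t1 * t2]mulrA invrM ?unitrMl // -scalerAl mulrVK.
have eB : recip_sum (t3 * t0) = q *: (t1 * t2) + q^-1 *: (t1 * t2)^-1.
  by rewrite e30 /recip_sum invrZ // ?unitrV ?unitrMl // !invrK addrC.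
have eS : q *: (t0 * t1 * t2) + q^-1 *: (t0 * t1 * t2)^-1 = recip_sum t3.
  rewrite e012 invrZ // ?unitrV // !invrK !scalerA mulfV // mulVf // !scale1r.
  by rewrite addrC.
have := AW_identity u0 u1 u2 c0 c1 c2 c3 eS; rewrite -eB => e.
rewrite /AW_comb; set D := q ^+ 2 - q ^- 2 in e *.
have D0 : D != 0 := q2_subV_neq0.
have -> : recip_sum (t1 * t0) = D^-1 *: (D *: recip_sum (t1 * t0)).
  by rewrite scalerA mulVf // scale1r.
rewrite -scalerDr e !scalerA -/(daha_alpha t0 t1 t2 t3).
suff -> : (q + q^-1) / D * (q - q^-1) = 1 by rewrite scale1r.
by rewrite mulrAC [_ * (q - _)]mulrC -q2_subVE mulfV.
Qed.

(** The rotation changes t_3 only by conjugation with t_0, which commutes with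
    both reciprocal sums. *)
Lemma daha_rotate_recip_sum t0 t1 t2 t3 : daha_quadruple t0 t1 t2 t3 ->
  recip_sum (t0^-1 * t3 * t0) = recip_sum t3
  /\ recip_sum (t0^-1 * t3 * t0 * t0) = recip_sum (t3 * t0).
Proof.
case=> u0 _ _ u3 c0 _ _ c3 _; split.
  by apply: recip_sum_conj_fixed => //; exact/esym/c3.
rewrite -[t0^-1 * t3 * t0]mulrA recip_sum_conj_fixed ?unitrMl //.
exact: recip_sum_comm.
Qed.

Lemma daha_AW_relations t0 t1 t2 t3 (a := recip_sum (t1 * t0))
    (b := recip_sum (t3 * t0)) (c := recip_sum (t2 * t0)) :
  daha_quadruple t0 t1 t2 t3 ->
  [/\ (q + q^-1) *: AW_comb q a b c = daha_alpha t0 t1 t2 t3,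
      (q + q^-1) *: AW_comb q b c a = daha_alpha t0 t3 t1 t2
    & (q + q^-1) *: AW_comb q c a b = daha_alpha t0 t2 t3 t1].
Proof.
move=> h; have h' := daha_rotate h; have h'' := daha_rotate h'.
have [T3 b_rot] := daha_rotate_recip_sum h.
have [T2 c_rot] := daha_rotate_recip_sum h'.
split; first exact: daha_AW_comb.
  by have := daha_AW_comb h'; rewrite b_rot /daha_alpha T3.
by have := daha_AW_comb h''; rewrite c_rot b_rot /daha_alpha T3 T2.
Qed.

(** In general daha_alpha is not central, but it is built from t_0, t_0^-1 and
    central elements. *)
Lemma daha_alpha_comm t0 t1 t2 t3 w :
  central (recip_sum t1) -> central (recip_sum t2) -> central (recip_sum t3) ->
  GRing.comm t0 w -> GRing.comm (daha_alpha t0 t1 t2 t3) w.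
Proof.
move=> c1 c2 c3 w0; rewrite /daha_alpha; apply/commr_sym.
apply: commrD; apply: commrM; try exact/esym.
have w0' := commr_sym w0.
apply: commrD; rewrite /GRing.comm -scalerAl -scalerAr; congr (_ *: _) => //.
exact: commrV.
Qed.

Lemma scaled_comm (k : F) u v w :
  k != 0 -> k *: u = v -> GRing.comm v w -> GRing.comm u w.
Proof.
by move=> k0 <-; rewrite /GRing.comm -scalerAl -scalerAr => /(scalerI k0).
Qed.

End DahaQuadruples.

(** * Homomorphisms out of the two presented algebras *)

Lemma hom_commutator_eq0 (F : fieldType) (A B : algType F)
    (f : {lrmorphism A -> B}) x y :
  GRing.comm (f x) (f y) -> f (x * y - y * x) = 0.
Proof. by move=> fxy; rewrite rmorphB !rmorphM fxy subrr. Qed.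

Lemma AW_comb_morph (F : fieldType) (q : F) (A B : algType F)
    (f : {lrmorphism A -> B}) x y z :
  f (AW_comb q x y z) = AW_comb q (f x) (f y) (f z).
Proof.
rewrite /AW_comb raddfD /= [f (_ *: _)]linearZ /= raddfB /=.
by rewrite ![f (_ *: _)]linearZ /= !rmorphM.
Qed.

Lemma ord3_ind (P : 'I_3 -> Prop) : P 0 -> P 1 -> P 2 -> forall i, P i.
Proof.
move=> P0 P1 P2 [[|[|[|//]]] lti].
- by rewrite (_ : Ordinal lti = 0) //; exact: val_inj.
- by rewrite (_ : Ordinal lti = 1) //; exact: val_inj.
- by rewrite (_ : Ordinal lti = 2) //; exact: val_inj.
Qed.

Section Homomorphisms.
Variables (F : fieldType) (q : F) (B : algType F).

(** A relation of Delta_q asserts commutation with every element, but in the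
    image it is enough to commute with the three generators. *)
Lemma AW_lift (a b c : B) :
  let x := AW_comb q a b c in let y := AW_comb q b c a in
  let z := AW_comb q c a b in
  [/\ GRing.comm x a, GRing.comm x b & GRing.comm x c] ->
  [/\ GRing.comm y a, GRing.comm y b & GRing.comm y c] ->
  [/\ GRing.comm z a, GRing.comm z b & GRing.comm z c] ->
  exists f : {lrmorphism AW_algebra q -> B},
    [/\ f (AW_A q) = a, f (AW_B q) = b & f (AW_C q) = c].
Proof.
move=> x y z [xa xb xc] [ya yb yc] [za zb zc].
have [f fE] := free_lift (fun i : 'I_3 => nth 0 [:: a; b; c] i).
have fcomm w : GRing.comm w a -> GRing.comm w b -> GRing.comm w c ->
    forall v, GRing.comm w (f v).
  move=> wa wb wc; apply: comm_free_image.
  by apply: ord3_ind; rewrite fE.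
have frel v : AW_rel q v -> f v = 0.
  by case=> {}v; apply: hom_commutator_eq0; rewrite AW_comb_morph !fE;
    exact: fcomm.
have [g gE] := quot_lift (@AW_proper F q) frel.
by exists g; rewrite /AW_A /AW_B /AW_C !gE !fE.
Qed.

Lemma AW_hom_ext (f g : {lrmorphism AW_algebra q -> B}) :
  f (AW_A q) = g (AW_A q) -> f (AW_B q) = g (AW_B q) ->
  f (AW_C q) = g (AW_C q) -> f =1 g.
Proof.
move=> eA eB eC u; rewrite -[u]quot_reprK.
elim/free_alg_ind: (quot_repr u) => [|i|x y ex ey|x y ex ey|c x ex].
- by rewrite !rmorph1.
- by elim/ord3_ind: i.
- by rewrite !raddfD /= ex ey.
- by rewrite !rmorphM /= ex ey.
- by rewrite !linearZ /= ex.
Qed.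

End Homomorphisms.

(** Only the DAHA relations matter, so the target may be any algebra with a
    quadruple that satisfies them. *)
Lemma AW_hom_of_quadruple (F : fieldType) (q : F) (R : unitAlgType F)
    (t0 t1 t2 t3 : R) :
  q != 0 -> q ^+ 4 != 1 -> daha_quadruple q t0 t1 t2 t3 ->
  exists f : {lrmorphism AW_algebra q -> R},
    [/\ f (AW_A q) = recip_sum (t1 * t0), f (AW_B q) = recip_sum (t3 * t0)
      & f (AW_C q) = recip_sum (t2 * t0)]
    /\ [/\ f (AW_alpha q) = daha_alpha q t0 t1 t2 t3,
           f (AW_beta q) = daha_alpha q t0 t3 t1 t2
         & f (AW_gamma q) = daha_alpha q t0 t2 t3 t1].
Proof.
move=> q_neq0 q4_neq1 h; have k0 := q_addV_neq0 q_neq0 q4_neq1.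
have [eA eB eC] := daha_AW_relations q_neq0 q4_neq1 h.
have [u0 u1 u2 u3 c0 c1 c2 c3 _] := h.
have t0_comm t : t \is a GRing.unit -> central (recip_sum t) ->
  GRing.comm t0 (recip_sum (t * t0)) by move=> *; exact: recip_sum_comm.
have [||| f [fA fB fC]] := @AW_lift F q R (recip_sum (t1 * t0))
    (recip_sum (t3 * t0)) (recip_sum (t2 * t0)).
- by split; apply: (scaled_comm k0 eA); apply: daha_alpha_comm; auto.
- by split; apply: (scaled_comm k0 eB); apply: daha_alpha_comm; auto.
- by split; apply: (scaled_comm k0 eC); apply: daha_alpha_comm; auto.
exists f; split=> //; rewrite -eA -eB -eC -fA -fB -fC.
by split; rewrite -AW_comb_morph; exact: linearZ.
Qed.

Lemma DAHA_quadruple (F : fieldType) (q : F) (q_neq0 : q != 0) :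
  daha_quadruple q (DAHA_t q_neq0 0) (DAHA_t q_neq0 1)
                   (DAHA_t q_neq0 2) (DAHA_t q_neq0 3).
Proof.
have u i : DAHA_t q_neq0 i \is a GRing.unit by case: (DAHA_t_inv q_neq0 i).
have c i : central (recip_sum (DAHA_t q_neq0 i)).
  move=> w; rewrite /recip_sum; have [_ ->] := DAHA_t_inv q_neq0 i.
  rewrite -[w]quot_reprK.
  rewrite -[DAHA_t _ _ + _](raddfD (quot_pi (DAHA_proper q_neq0))) -!rmorphM.
  exact: quot_relB (DAHA_rel_central q i (quot_repr w)).
split=> //.
have := quot_relB (DAHA_proper q_neq0) (DAHA_rel_prod q).
by rewrite !rmorphM linearZ rmorph1.
Qed.

Theorem theorem4p1 (F : fieldType) (q : F) (q_neq0 : q != 0)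
    (q4_neq1 : q ^+ 4 != 1) :
  let t0 := DAHA_t q_neq0 0 in
  let t1 := DAHA_t q_neq0 1 in
  let t2 := DAHA_t q_neq0 2 in
  let t3 := DAHA_t q_neq0 3 in
  let sends_generators (phi : {lrmorphism AW_algebra q -> DAHA q_neq0}) :=
    [/\ phi (AW_A q) = t1 * t0 + (t1 * t0)^-1,
        phi (AW_B q) = t3 * t0 + (t3 * t0)^-1
      & phi (AW_C q) = t2 * t0 + (t2 * t0)^-1] in
  exists psi : {lrmorphism AW_algebra q -> DAHA q_neq0},
    [/\ sends_generators psi,
        forall phi : {lrmorphism AW_algebra q -> DAHA q_neq0},
          sends_generators phi -> phi =1 psi,
        psi (AW_alpha q) =
          (q^-1 *: t0 + q *: t0^-1) * (t1 + t1^-1)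
          + (t2 + t2^-1) * (t3 + t3^-1),
        psi (AW_beta q) =
          (q^-1 *: t0 + q *: t0^-1) * (t3 + t3^-1)
          + (t1 + t1^-1) * (t2 + t2^-1)
      & psi (AW_gamma q) =
          (q^-1 *: t0 + q *: t0^-1) * (t2 + t2^-1)
          + (t3 + t3^-1) * (t1 + t1^-1)].
Proof.
move=> t0 t1 t2 t3 sends_generators.
have [psi [[psiA psiB psiC] [psi_alpha psi_beta psi_gamma]]] :=
  AW_hom_of_quadruple q_neq0 q4_neq1 (DAHA_quadruple q_neq0).
exists psi; split.
- by split; [exact: psiA | exact: psiB | exact: psiC].
- move=> phi [phiA phiB phiC]; apply: AW_hom_ext.
  + exact: etrans phiA (esym psiA).
  + exact: etrans phiB (esym psiB).
  + exact: etrans phiC (esym psiC).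
- exact: psi_alpha.
- exact: psi_beta.
- exact: psi_gamma.
Qed.
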